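(* For every integer $k\ge 0$ the following three identities hold. In the ring of polynomials in noncommuting indeterminates $a_1,a_2,\dots$ with integer coefficients, $$\sum_{\boldsymbol{\lambda} \in \mathbf{C}_k} \prod_{j=1}^\ell(-1+a_{\lambda_j})=-\sigma(k)+\sum_{m \in \mathcal{U}_{k-1} } (-1)^{g_{k-1}(m)}\, m+\sum_{m \in \mathcal{U}_k } (-1)^{g_k(m)}\, m ,$$ where the product is taken from left to right as $(-1+a_{\lambda_1})(-1+a_{\lambda_2})\cdots(-1+a_{\lambda_\ell})$. Moreover, in $\mathbb{Z}$, $$\sum_{\boldsymbol{\lambda} \in \mathbf{C}_k} (-1)^\ell=-\sigma(k),$$ and $$-\sigma(k)+\sum_{m \in \mathcal{U}_{k-1} } (-1)^{g_{k-1}(m)}+\sum_{m \in \mathcal{U}_k } (-1)^{g_k(m)} =0 .$$ Here $\ell$ denotes the length of $\boldsymbol{\lambda}$.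
   Context: $\mathbf{C}_k$ is the set of finite integer sequences $\boldsymbol{\lambda}=[\lambda_1,\dots,\lambda_\ell]$, $\ell\ge 1$, with $k\ge\lambda_1$, $\lambda_\ell=1$, and $\lambda_j\ge\lambda_{j+1}+2$ for $1\le j<\ell$ (so $\mathbf{C}_0=\emptyset$). For an integer $k\ge -1$, $\mathcal{U}_k$ is the set of monomials $m=a_{\lambda_1}a_{\lambda_2}\cdots a_{\lambda_\ell}$, $\ell\ge 1$, whose index $[\lambda_1,\dots,\lambda_\ell]$ satisfies: (U1) $k\ge\lambda_1>\lambda_2>\dots>\lambda_\ell\ge1$; (U2) $\lambda_1\equiv k\pmod 3$; (U3) $\lambda_j\not\equiv\lambda_{j+1}+1\pmod 3$ for $1\le j<\ell$; (U4) $\lambda_\ell\not\equiv 2\pmod 3$. (In particular $\mathcal{U}_{-1}=\mathcal{U}_0=\emptyset$.) For a monomial $m\in\mathcal{U}_k$ with index $[\lambda_1,\dots,\lambda_\ell]$, $g_k(m)$ is the maximum number of pairwise disjoint sets of three consecutive integers whose union is a subset of $\{-1,0,1,\dots,k\}\setminus\{\lambda_1,\dots,\lambda_\ell\}$. $\sigma(k)=\frac{2\sqrt3}{3}\sin\left(\frac{k\pi}{3}\right)$, the 6-periodic sequence $0,1,1,0,-1,-1,\dots$ for $k=0,1,2,\dots$. *)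

(* Defs.v *)
From mathcomp Require Import all_boot all_order all_algebra.
From mathcomp Require Import finmap.
From mathcomp Require Import boolp classical_sets functions cardinality fsbigop.
From mathcomp Require Import reals trigo.
From mathcomp.multinomials Require Import monalg.

Set Implicit Arguments.
Unset Strict Implicit.
Unset Printing Implicit Defensive.

Import Order.TTheory GRing.Theory Num.Theory.

Local Open Scope classical_set_scope.
Local Open Scope ring_scope.

(* The free algebra Z<a_0, a_1, a_2, ...>: its monomials form the free monoid
   on [nat]. The indeterminate a_0 is superfluous: it never occurs below, as
   every index sequence that is used consists of positive integers. *)
Notation ncpoly := {malg int[{fmonom nat}]} (only parsing).

Definition a (i : nat) : ncpoly := << fmu i >>.

(* The least entry of a sequence in [C k] is 1, so that it is harmless to take
   the entries in [nat]. *)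
Definition C (k : nat) : set (seq nat) :=
  [set l | [/\ (0 < size l)%N, (head 0 l <= k)%N, last 0%N l = 1%N
             & sorted (fun x y => (y + 2 <= x)%N) l]].

(* A monomial a_{l_1} ... a_{l_r} is represented by its index [l_1, ..., l_r],
   which determines it. *)
Definition U (k : int) : set (seq nat) :=
  [set l | [/\ (0 < size l)%N,
               [/\ (head 0%N l)%:Z <= k, sorted (fun x y => (y < x)%N) l
                 & (1 <= last 0 l)%N],
               ((head 0%N l)%:Z = k %[mod 3])%Z,
               sorted (fun x y => x != y + 1 %[mod 3])%N l
             & (last 0 l <> 2 %[mod 3])%N]].

Definition monomial (l : seq nat) : ncpoly := \prod_(i <- l) a i.

(* {-1, 0, ..., k} minus the entries of [l], for k >= -1. *)
Definition gap (k : int) (l : seq nat) : {fset int} :=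
  ([fset (i%:Z - 1)%R | i in iota 0 `|(k + 2)%R|%N]
     `\` [fset i%:Z | i in l])%fset.

Definition triples (A : {fset int}) : {fset {fset int}} :=
  [fset B in fpowerset A
     | `[< exists t : int, B = [fset t; (t + 1)%R; (t + 2)%R] >]]%fset.

Definition g (k : int) (l : seq nat) : nat :=
  \max_(P <- fpowerset (triples (gap k l)) | trivIfset P) #|` P|.

Definition sigma (R : realType) (k : nat) : R :=
  2 * Num.sqrt 3 / 3 * sin (k%:R * pi / 3).

(* [C k] and [U k] are finite, hence the finitely supported sums [\sum_(l \in _)]
   over them are the usual finite sums. *)
Lemma finite_decreasing (n : nat) :
  finite_set [set l : seq nat |
    sorted (fun x y => (y < x)%N) l /\ all (fun x => (x < n)%N) l].
Proof.
elim: n => [|n IHn].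
  apply: (sub_finite_set (B := [set [::]])); last exact: finite_set1.
  by case=> [|x l] //= [_].
set S := [set l | _] in IHn; apply: (sub_finite_set (B := S `|` cons n @` S));
  last by rewrite finite_setU; split; last exact: finite_image.
have lt_trans : transitive (fun x y : nat => (y < x)%N).
  by move=> y x z xy yz; exact: ltn_trans yz xy.
case=> [|x l] [sl /= al]; first by left.
have /andP[lx sl'] : all (fun y => (y < x)%N) l && sorted (fun x y => (y < x)%N) l.
  by move: sl; rewrite /= path_sortedE.
case/andP: al; rewrite ltnS leq_eqVlt => /orP[/eqP xn _|xn _].
  by right; exists l; [split=> //; rewrite -xn|rewrite xn].
left; split=> //=; rewrite xn /=.
by apply: sub_all lx => y /ltn_trans; exact.
Qed.

Lemma decreasing_lt (n : nat) (l : seq nat) :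
  sorted (fun x y => (y < x)%N) l -> (head 0 l <= n)%N ->
  all (fun x => (x < n.+1)%N) l.
Proof.
case: l => [|x l] //=; rewrite path_sortedE => [/andP[lx _] xn|y u v].
  rewrite ltnS xn /=.
  by apply: sub_all lx => y /ltnW /leq_trans; exact.
by move=> uy yv; exact: ltn_trans yv uy.
Qed.

Lemma finite_C (k : nat) : finite_set (C k).
Proof.
apply: sub_finite_set (finite_decreasing k.+1) => l [_ lk _ sl].
have sl' : sorted (fun x y => (y < x)%N) l.
  by apply: sub_sorted sl => x y; rewrite addn2; exact: ltnW.
by split=> //; exact: decreasing_lt.
Qed.

Lemma finite_U (k : int) : finite_set (U k).
Proof.
apply: sub_finite_set (finite_decreasing `|k|%N.+1) => l [_ [lk sl _] _ _ _].
split=> //; apply: decreasing_lt => //.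
by rewrite -lez_nat (le_trans lk)// abszE ler_norm.
Qed.

(* Main.v *)
Require Import Defs.
From mathcomp Require Import all_boot all_order all_algebra.
From mathcomp Require Import finmap.
From mathcomp Require Import boolp classical_sets functions cardinality fsbigop.
From mathcomp Require Import reals trigo.
From mathcomp.multinomials Require Import monalg.
From mathcomp Require Import zify ring lra.

Set Implicit Arguments.
Unset Strict Implicit.
Unset Printing Implicit Defensive.

Import Order.TTheory GRing.Theory Num.Theory.

Local Open Scope ring_scope.

(** The first identity is proved over an arbitrary ring, with any elements
    [x 0], [x 1], ... in place of the indeterminates. The other two are then
    evaluations of it in [int]: at [x = 0] every product over [U] vanishes,
    because the sequences in [U] are nonempty, and at [x = 1] every product over
    [C] vanishes.

    Call [P k] the left-hand side [sumC k] and [V k] the signed sum [sumU k]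
    over [U k]. Splitting the sequences according to whether their head is [k]
    yields two recurrences. For [C] it is immediate ([sumC_rec]):

      [P k = P (k - 1) + (-1 + x k) * (P (k - 2) + [k = 1])].

    For [U] it is [sumU_rec]:

      [V k = - V (k - 3) + x k * (V (k - 3) + V (k - 2) + e k)].

    Here a sequence of [U k] that does not start with [k] has its head at most
    [k - 3], by the congruence on the head, and raising the bound from [k - 3]
    to [k] puts three new consecutive integers above everything else, which
    raises the packing number [g] by one ([g_add3]) and changes the sign. If the
    sequence starts with [k], its next entry is congruent to [k] or to [k - 2]
    modulo 3, so that the tail lies in [U (k - 3)] or [U (k - 2)] (or is empty,
    which gives the term [e k]); the sign does not change, because fewer than
    three integers are added to a run whose length is a multiple of 3
    ([g_U_add]).

    For [k > 1] the coefficient [e k] is [- sigma (k - 2)] ([coefU1E]), and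
    since [sigma k = sigma (k - 1) - sigma (k - 2)], the expression
    [- sigma k + V (k - 1) + V k] obeys the recurrence of [P]. The values for
    [k = 0] and [k = 1] agree too, so the two are equal ([sumC_eq_sumU]). *)

(** * Packing triples of consecutive integers *)

Section Packing.
Local Open Scope fset_scope.

(** [g k l] is by definition [packing (gap k l)]. *)
Definition packing (A : {fset int}) : nat :=
  \max_(P <- fpowerset (triples A) | trivIfset P) #|` P|.

Lemma mem_triples (A B : {fset int}) :
  reflect (B `<=` A /\ exists t : int, B = [fset t; (t + 1)%R; (t + 2)%R])
          (B \in triples A).
Proof.
rewrite /triples !inE fpowersetE /=.
by apply: (iffP andP) => -[? /asboolP ?].
Qed.

Lemma packing_geq (A : {fset int}) (P : {fset {fset int}}) :
  P `<=` triples A -> trivIfset P -> (#|` P| <= packing A)%N.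
Proof. by move=> PA tP; apply: leq_bigmax_seq => //; rewrite fpowersetE. Qed.

Lemma packing_leq (A : {fset int}) (n : nat) :
  (forall P, P `<=` triples A -> trivIfset P -> (#|` P| <= n)%N) ->
  (packing A <= n)%N.
Proof. by move=> H; apply/bigmax_leqP_seq => P; rewrite fpowersetE; exact: H. Qed.

(** A triple that is not contained in [A] meets the new one, hence contains its
    least element [t], as nothing in the union lies beyond [t + 2]. So a disjoint
    family has at most one such triple; conversely, the new triple can be added
    to any disjoint family in [A]. *)
Lemma packing_add3 (A : {fset int}) (t : int) :
  (forall y, y \in A -> y < t)%R ->
  packing (A `|` [fset t; (t + 1)%R; (t + 2)%R]) = (packing A).+1.
Proof.
move=> At; set T := [fset t; (t + 1)%R; (t + 2)%R].
have memT y : y \in T = (t <= y <= t + 2)%R by rewrite !inE; lia.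
apply/eqP; rewrite eqn_leq; apply/andP; split.
- apply: packing_leq => P PA /trivIfsetP tP.
  pose P1 := [fset B in P | t \notin B]; pose P2 := [fset B in P | t \in B].
  have -> : P = P1 `|` P2.
    by apply/fsetP => B; rewrite !inE /=; case: (B \in P); case: (t \in B).
  have P2le1 : (#|` P2| <= 1)%N.
    rewrite leqNgt cardfE; apply/negP => /card_gt1P [B1 [B2 [_ _ B12]]].
    have := valP B1; have := valP B2; rewrite !inE /= => /andP[B2P tB2] /andP[B1P tB1].
    have /fdisjointP/(_ _ tB1) := tP _ _ B1P B2P B12.
    by rewrite tB2.
  have P1le : (#|` P1| <= packing A)%N.
    apply: packing_geq; last first.
      by apply/trivIfsetP => B B'; rewrite !inE /= => /andP[? _] /andP[? _]; exact: tP.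
    apply/fsubsetP => B BP1.
    have /andP[BP tB] : (B \in P) && (t \notin B) by move: BP1; rewrite !inE.
    have /mem_triples[BA [s Bs]] := fsubsetP PA _ BP.
    apply/mem_triples; split; last by exists s.
    have memB y : y \in B = (s <= y <= s + 2)%R by rewrite Bs !inE; lia.
    apply/fsubsetP => y yB; have := fsubsetP BA _ yB; rewrite inE memT.
    case/orP => // ty.
    (* The top [s + 2] of [B] is at least [y], hence in the new triple; as [s]
       is at most [t], avoiding [t] is impossible. *)
    have := fsubsetP BA (s + 2)%R; rewrite memB inE memT.
    have [/At|_] := boolP ((s + 2)%R \in A); last by move: tB yB; rewrite !memB; lia.
    by move: tB yB; rewrite !memB; lia.
  by rewrite cardfsU (leq_trans (leq_subr _ _))// -addn1 leq_add.
- have add_triple P : P `<=` triples A -> trivIfset P ->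
    (#|` P| < packing (A `|` T))%N.
    move=> PA /trivIfsetP tP.
    have PT B : B \in P -> [disjoint B & T].
      move=> /(fsubsetP PA)/mem_triples[/fsubsetP BA _].
      by apply/fdisjointP => y /BA/At; rewrite memT; lia.
    have TP : T \notin P.
      apply/negP => /PT/fdisjointP/(_ t); rewrite memT; lia.
    rewrite -[(#|` P|).+1]/(true + #|` P|)%N -TP -cardfsU1.
    apply: packing_geq.
      apply/fsubsetP => B /fset1UP[->|/(fsubsetP PA)/mem_triples[BA Bt]];
        apply/mem_triples; split=> //.
      - exact: fsubsetUr.
      - by exists t.
      - exact: fsubset_trans BA (fsubsetUl _ _).
    apply/trivIfsetP => B B' /fset1UP[->|BP] /fset1UP[->|B'P]; rewrite ?eqxx// => BB'.
    - by rewrite fdisjoint_sym; exact: PT.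
    - exact: PT.
    - exact: tP.
  have pos : (0 < packing (A `|` T))%N.
    have := @add_triple fset0 (fsub0set _); rewrite cardfs0; apply.
    by apply/trivIfsetP => B; rewrite inE.
  rewrite -(prednK pos) ltnS; apply: packing_leq => P PA tP.
  by have := add_triple P PA tP; lia.
Qed.

End Packing.

(** * The packing number of the complement of a sequence *)

Lemma mem_gap (k : int) (l : seq nat) y : -2 <= k ->
  (y \in gap k l) = (-1 <= y <= k) && (y \notin [seq i%:Z | i <- l]).
Proof.
move=> k2; rewrite /gap inE andbC; congr (_ && ~~ _).
  apply/imfsetP/idP => /= [[i]|/andP[y1 y2]].
    by rewrite mem_iota => ? ->; lia.
  by exists `|(y + 1)%R|%N; rewrite ?mem_iota; lia.
by apply/imfsetP/mapP => /= -[i il ->]; exists i.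
Qed.

Lemma g_add3 (k : int) (l : seq nat) :
  -2 <= k -> (forall i, i \in l -> i%:Z <= k) -> g (k + 3) l = (g k l).+1.
Proof.
move=> k2 lk; rewrite -[g _ _]/(packing _) -[g k l]/(packing _).
rewrite -(packing_add3 (t := k + 1)); last by move=> y; rewrite mem_gap//; lia.
congr packing; apply/fsetP => y; rewrite in_fsetU !mem_gap ?inE; [|lia..].
have [/mapP[i /lk ik ->]|_] := boolP (y \in _); lia.
Qed.

(** The at most two integers above [h] are cut off by [h], which is missing, so
    that no triple uses them. *)
Lemma g_top_gap (h r : nat) (l : seq nat) : (r < 3)%N ->
  (forall i, i \in l -> (i < h)%N) -> g (h + r)%:Z (h :: l) = g (h%:Z - 1) l.
Proof.
move=> r3 lh; rewrite /g; congr (\max_(P <- fpowerset _ | _) _).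
apply/fsetP => B; apply/mem_triples/mem_triples => -[BA [t Bt]]; split; try by exists t.
all: have memB y : (y \in B) = (t <= y <= t + 2) by rewrite Bt !inE; lia.
all: apply/fsubsetP => y yB; have := fsubsetP BA y yB.
all: have := fsubsetP BA (t + 2); have := fsubsetP BA (t + 1); have := fsubsetP BA t.
all: move: yB; rewrite !memB !mem_gap ?inE; try lia.
all: have [/mapP[i /lh ? ->]|_] := boolP (y \in _); lia.
Qed.

Lemma g_nil (n : nat) : g (n%:Z - 2) [::] = (n %/ 3)%N.
Proof.
have [m] := ubnP n; elim: m n => // m IHm n nm.
have [n3|n3] := leqP 3 n.
  have -> : n%:Z - 2 = (n - 3)%N%:Z - 2 + 3 by lia.
  by rewrite g_add3 ?IHm//; lia.
rewrite divn_small// -[LHS]/(packing _).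
apply/eqP; rewrite -leqn0; apply: packing_leq => P PA _.
rewrite leqn0 cardfs_eq0; apply/eqP/fsetP => B; rewrite in_fset0.
apply/negP => /(fsubsetP PA)/mem_triples[/fsubsetP BA [t Bt]].
(* The complement lies in [-1, 0], too short to hold both [t] and [t + 2]. *)
have := BA t; have := BA (t + 2); rewrite Bt !mem_gap ?inE; lia.
Qed.

(** The run of integers above the head [h] holds as many disjoint triples as a
    run of its length can, independently of what lies below. *)
Lemma g_run (h q r : nat) (l : seq nat) : (r < 3)%N ->
  (forall i, i \in l -> (i < h)%N) ->
  g (h + 3 * q + r)%:Z (h :: l) = (q + g (h%:Z - 1) l)%N.
Proof.
move=> r3 lh; elim: q => [|q IHq]; first by rewrite muln0 addn0 g_top_gap.
have -> : (h + 3 * q.+1 + r)%:Z = (h + 3 * q + r)%:Z + 3 by lia.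
by rewrite g_add3 ?IHq//= => i; rewrite inE => /orP[/eqP ->|/lh]; lia.
Qed.

Lemma g_cons (k : nat) (l : seq nat) : (forall i, i \in l -> (i < k)%N) ->
  g k%:Z (k :: l) = g (k%:Z - 1) l.
Proof. by move=> lk; have := @g_top_gap k 0 l isT lk; rewrite addn0. Qed.

Lemma decreasing_head_gt (x : nat) (l : seq nat) :
  sorted (fun x y => (y < x)%N) (x :: l) -> forall i, i \in l -> (i < x)%N.
Proof.
rewrite /= path_sortedE => [/andP[/allP]//|y u v uy yv].
exact: ltn_trans yv uy.
Qed.

(** The form in which membership in [U k] enters the computation of [g]: the run
    of integers from the head to [k] has length [3 * q]. *)
Lemma U_head (k : int) (l : seq nat) : U k l ->
  exists h q l', [/\ l = h :: l', k = (h + 3 * q)%N%:Z, (0 < h)%N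
                   & forall i, i \in l' -> (i < h)%N].
Proof.
case: l => [|h l]; first by case.
case=> _ [/= hk sl l1] hk3 _ _; exists h, `|((k - h%:Z) %/ 3)%Z|%N, l.
split=> //; first lia; last exact: decreasing_head_gt.
by case: l sl l1 {hk} => //= y l /andP[]; lia.
Qed.

Lemma g_U_add (k : int) (r : nat) (l : seq nat) :
  U k l -> (r < 3)%N -> g (k + r%:Z) l = g k l.
Proof.
move=> /U_head[h [q [l' [-> -> _ lh]]]] r3.
by rewrite -PoszD g_run// -[(_ + _)%N in RHS]addn0 g_run.
Qed.

Lemma g_U_add3 (k : int) (l : seq nat) : U k l -> g (k + 3) l = (g k l).+1.
Proof.
move=> /U_head[h [q [l' [-> -> _ lh]]]]; rewrite g_add3// => i.
by rewrite inE => /orP[/eqP ->|/lh]; lia.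
Qed.

(** * Splitting the index sets by their head *)

Section IndexSets.
Local Open Scope classical_set_scope.
Local Open Scope ring_scope.

Lemma U_neg (k : int) : k <= 0 -> U k = set0.
Proof.
move=> k0; apply/seteqP; split=> // l /U_head[h [q [l' [_ kE h0 _]]]].
by lia.
Qed.

Lemma finite_sub_nil (P : Prop) : finite_set [set l : seq nat | l = [::] /\ P].
Proof. by apply: sub_finite_set (finite_set1 [::]) => l []. Qed.

(** After the head [k], the next entry may not be congruent to [k - 1], and it is
    less than [k]: so it is congruent to, and at most, [k - 3] or [k - 2]. The
    tail may be empty unless [k], then also the last entry, is congruent to 2. *)
Lemma U_rec (k : nat) : (0 < k)%N ->
  U k%:Z = U (k%:Z - 3) `|`
    cons k @` (U (k%:Z - 3) `|` U (k%:Z - 2)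
               `|` [set l | l = [::] /\ (k %% 3 <> 2)%N]).
Proof.
move=> k0; apply/seteqP; split=> [[|x l]|l']; first by case.
- case=> _ [/= xk sl l1] xk3 dl ll.
  have [xE|xk'] := eqVneq x k; [subst x; right|left].
    exists l => //; case: l sl l1 dl ll => [|y l] /= sl l1 dl ll.
      by right; split=> //; move: ll => /=; lia.
    left; move: sl dl => /andP[yx sl] /andP[dyx dl].
    have [yx3|yx3] := eqVneq (y %% 3)%N (k %% 3)%N; [left|right]; split=> //=.
      by split=> //; lia.
      by lia.
      by split=> //; lia.
      by lia.
  by split=> //=; [split=> //; lia|lia].
- case=> [[l0 [hk sl l1] hk3 dl ll]|]; first by split=> //; [split=> //; lia|lia].
  case=> l H <-; case: H => [[|]|[-> k3]]; last by split=> //=; split=> //; lia.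
    case: l => [[]//|y l] [_ [/= yk sl l1] yk3 dl ll].
    split=> //=; first (by rewrite sl andbT; split=> //; lia).
    by rewrite dl andbT; lia.
  case: l => [[]//|y l] [_ [/= yk sl l1] yk3 dl ll].
  split=> //=; first (by rewrite sl andbT; split=> //; lia).
  by rewrite dl andbT; lia.
Qed.

(** Entries of [C k] after the head [k] are at most [k - 2]; only [k = 1] may be
    followed by nothing, since the last entry is 1. The subtraction [k - 2]
    truncates harmlessly at [k = 1], because [C 0] is empty. *)
Lemma C_rec (k : nat) : (0 < k)%N ->
  C k = C k.-1 `|` cons k @` (C (k - 2)%N `|` [set l | l = [::] /\ k = 1%N]).
Proof.
move=> k0; apply/seteqP; split=> [[|x l]|l']; first by case.
- case=> _ /= xk l1 sl.
  have [xE|xk'] := eqVneq x k; [subst x; right|by left; split=> //=; lia].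
  exists l => //; case: l l1 sl => [|y l] /= l1 sl; first by right.
  by left; move: sl => /andP[xy sl]; split=> //=; lia.
- case=> [[l0 hk l1 sl]|]; first by split=> //; lia.
  case=> l H <-; case: H => [|[-> ->]//].
  case: l => [[]//|y l] [_ /= yk l1 sl]; split=> //=.
  have y0 : (0 < y)%N by case: l l1 sl {yk} => [|z l] /= l1; [lia|case/andP; lia].
  by rewrite sl andbT; lia.
Qed.

End IndexSets.

(** * The sequence sigma *)

Fixpoint sigmaZ (k : nat) : int :=
  if k is (k'.+1 as k1).+1 then sigmaZ k1 - sigmaZ k' else k%:Z.

Arguments sigmaZ : simpl never.

Lemma sigmaZ_rec k : sigmaZ k.+2 = sigmaZ k.+1 - sigmaZ k. Proof. by []. Qed.

Lemma sigmaZ_add3 (k : nat) : sigmaZ k.+3 = - sigmaZ k.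
Proof. by rewrite !sigmaZ_rec; ring. Qed.

Section Sigma.
Variable R : realType.

(** With [c = cos (pi / 3)], the formula for the triple angle gives
    [4 c^3 - 3 c = -1], that is [(c + 1) (2 c - 1)^2 = 0], and [c] is positive. *)
Lemma cos_pi3 : cos (pi / 3) = 1 / 2 :> R.
Proof.
have pi0 := pi_gt0 R.
have c0 : 0 < cos (pi / 3 : R) by apply: cos_gt0_pihalf; apply/andP; split; lra.
have : cos (pi / 3 + pi / 3 + pi / 3) = -1 :> R by rewrite -cospi; congr cos; field.
have := cos2Dsin2 (pi / 3 : R).
rewrite !(cosD, sinD).
move: c0; move: (cos _) (sin _) => c s c0 cs c3.
have : (c + 1) * (2 * c - 1) ^+ 2 = 0.
  have -> : (c + 1) * (2 * c - 1) ^+ 2 =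
    ((c * c - s * s) * c - (s * c + c * s) * s + 1) - 3 * c * (1 - (c ^+ 2 + s ^+ 2)) by ring.
  by rewrite cs c3; ring.
by move=> /eqP; rewrite mulf_eq0 sqrf_eq0 => /orP[] /eqP; lra.
Qed.

Lemma sin_pi3 : sin (pi / 3) = Num.sqrt 3 / 2 :> R.
Proof.
have pi0 := pi_gt0 R.
have s0 : 0 <= sin (pi / 3 : R) by apply: sin_ge0_pi; apply/andP; split; lra.
have := cos2Dsin2 (pi / 3 : R); rewrite cos_pi3 => cs.
apply/eqP; rewrite -(eqrXn2 (n := 2))// ?divr_ge0 ?sqrtr_ge0//.
by rewrite exprMn exprVn sqr_sqrtr//; apply/eqP; lra.
Qed.

(** Both sides obey the same recurrence, since
    [sin (y + pi/3) + sin (y - pi/3) = 2 sin y cos (pi/3) = sin y]. *)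
Lemma sigmaZE (k : nat) : (sigmaZ k)%:~R = sigma R k.
Proof.
have s3 : Num.sqrt 3 * Num.sqrt 3 = 3 :> R by rewrite -expr2 sqr_sqrtr.
have [m] := ubnP k; elim: m k => // m IHm [|[|k]] km.
- by rewrite /sigma !mul0r sin0 mulr0.
- by rewrite /sigma mul1r sin_pi3 (_ : sigmaZ 1 = 1)//; lra.
rewrite sigmaZ_rec rmorphB /= !IHm; [|lia..].
rewrite /sigma -mulrBr; congr (_ * _).
have -> : k.+2%:R * pi / 3 = k.+1%:R * pi / 3 + pi / 3 :> R by rewrite -[k.+2]addn1 natrD; field.
have -> : k%:R * pi / 3 = k.+1%:R * pi / 3 - pi / 3 :> R by rewrite -[k.+1]addn1 natrD; field.
by rewrite sinB sinD cos_pi3; lra.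
Qed.

End Sigma.

(** * Sums over the index sets in an arbitrary ring *)

Section Sums.
Local Open Scope classical_set_scope.
Local Open Scope ring_scope.

Lemma fsbig_setU_cons (A : zmodType) (k : nat) (S T : set (seq nat)) (F : seq nat -> A) :
  finite_set S -> finite_set T -> (forall l, S l -> (head 0 l < k)%N) ->
  \sum_(l \in S `|` cons k @` T) F l
    = \sum_(l \in S) F l + \sum_(l \in T) F (k :: l).
Proof.
move=> Sfin Tfin Sk; rewrite fsbigU0//; last 2 first.
- exact: finite_image.
- by move=> l [/Sk lk [l' _ lE]]; move: lk; rewrite -lE /= ltnn.
by congr (_ + _); apply: fsbig_image => l1 l2 _ _ [].
Qed.

Lemma fsbig_nil (A : zmodType) (P : Prop) (F : seq nat -> A) :
  \sum_(l \in [set l | l = [::] /\ P]) F l = if `[< P >] then F [::] else 0.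
Proof.
case: asboolP => p; last by apply: fsbig1 => l [].
by rewrite (_ : [set l | _] = [set [::]]) ?fsbig_set1//; apply/seteqP; split=> l // [].
Qed.

Lemma fsum_distrr (A : pzRingType) (c : A) (S : set (seq nat)) (F : seq nat -> A) :
  finite_set S -> c * (\sum_(l \in S) F l) = \sum_(l \in S) c * F l.
Proof. by move=> Sfin; rewrite !fsbig_finite// big_distrr. Qed.

Variables (A : pzRingType) (x : nat -> A).

Definition sumC (k : nat) : A := \sum_(l \in C k) \prod_(i <- l) (-1 + x i).

Definition sumU (k : int) : A :=
  \sum_(l \in U k) (-1) ^+ g k l * \prod_(i <- l) x i.

Lemma sumC0 : sumC 0 = 0.
Proof.
apply: fsbig1 => l [l0 l1]; case: l l0 l1 => [//|y l] /= _ y0 ll sl.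
by case: l ll sl => [|z l] /=; lia.
Qed.

Lemma C_lt (k : nat) (l : seq nat) : C k l -> (head 0 l < k.+1)%N.
Proof. by case. Qed.

Lemma sumC_rec (k : nat) : (0 < k)%N ->
  sumC k = sumC k.-1 + (-1 + x k) * (sumC (k - 2)%N + (k == 1%N)%:R).
Proof.
move=> k0; rewrite /sumC (C_rec k0) fsbig_setU_cons; first last.
- by move=> l /C_lt; lia.
- by rewrite finite_setU; split; [exact: finite_C|exact: finite_sub_nil].
- exact: finite_C.
congr (_ + _); under eq_fsbigr do rewrite big_cons.
rewrite -fsum_distrr; last first.
  by rewrite finite_setU; split; [exact: finite_C|exact: finite_sub_nil].
rewrite fsbigU0 ?fsbig_nil ?big_nil; first last.
- by move=> l [[l0 _ _ _] [lE _]]; rewrite lE in l0.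
- exact: finite_sub_nil.
- exact: finite_C.
by congr (_ * (_ + _)); case: asboolP; case: eqP.
Qed.

Lemma sumU_neg (k : int) : k <= 0 -> sumU k = 0.
Proof. by move=> k0; rewrite /sumU U_neg// fsbig_set0. Qed.

(** The coefficient in [sumU k] of the one-letter product [x k]. *)
Definition coefU1 (k : nat) : int :=
  if (k %% 3 == 2)%N then 0 else (-1) ^+ (k.+1 %/ 3).

(** The two terms [sumU (k - 3)] come from the sequences with head below [k],
    whose sign flips, and from the tails of those with head [k]. *)
Lemma sumU_rec (k : nat) : (0 < k)%N ->
  sumU k%:Z = - sumU (k%:Z - 3)
    + x k * (sumU (k%:Z - 3) + sumU (k%:Z - 2) + (coefU1 k)%:~R).
Proof.
move=> k0.
have UUfin : finite_set (U (k%:Z - 3) `|` U (k%:Z - 2)).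
  by rewrite finite_setU; split; exact: finite_U.
have Tfin : finite_set (U (k%:Z - 3) `|` U (k%:Z - 2)
                      `|` [set l | l = [::] /\ (k %% 3 <> 2)%N]).
  by rewrite finite_setU; split=> //; exact: finite_sub_nil.
rewrite {1}/sumU (U_rec k0) fsbig_setU_cons//; first last.
- by move=> l [_ [? _ _] _ _ _]; lia.
- exact: finite_U.
congr (_ + _).
  rewrite -[- sumU _]mulN1r /sumU fsum_distrr; last exact: finite_U.
  apply: eq_fsbigr => l; rewrite inE => Ul.
  by rewrite -{1}[k%:Z](subrK 3) g_U_add3// exprS mulrA.
rewrite (eq_fsbigr (fun l => x k * ((-1) ^+ g (k%:Z - 1) l * \prod_(i <- l) x i))); last first.
  move=> l; rewrite inE => Tl; rewrite big_cons g_cons.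
    by rewrite !mulrA; congr (_ * _); exact/commr_sym/commr_sign.
  by case: Tl => [[|]/U_head[h [q [l' [-> kE _ lh]]]] i|[-> _]//];
    rewrite inE => /orP[/eqP ->|/lh]; lia.
rewrite -fsum_distrr//; congr (_ * _).
rewrite fsbigU0//; first last.
- by move=> l [[[l0 _ _ _ _]|[l0 _ _ _ _]] [lE _]]; rewrite lE in l0.
- exact: finite_sub_nil.
congr (_ + _).
  rewrite fsbigU0; first last.
  - by move=> l [/= [_ _ h3 _ _] [_ _ h2 _ _]]; lia.
  - exact: finite_U.
  - exact: finite_U.
  congr (_ + _); apply: eq_fsbigr => l; rewrite inE => Ul.
    have -> : k%:Z - 1 = k%:Z - 3 + 2%N%:Z by lia.
    by rewrite g_U_add.
  have -> : k%:Z - 1 = k%:Z - 2 + 1%N%:Z by lia.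
  by rewrite g_U_add.
have -> : k%:Z - 1 = k.+1%:Z - 2 by lia.
rewrite fsbig_nil g_nil big_nil mulr1 /coefU1.
by case: asboolP; case: eqP => // _ _; rewrite ?rmorphXn ?rmorphN1 ?rmorph0.
Qed.

(** Both sides change sign when [k] increases by 3. *)
Lemma coefU1E (k : nat) : coefU1 k.+2 = - sigmaZ k.
Proof.
have [m] := ubnP k; elim: m k => // m IHm [|[|[|k]]] // km.
rewrite sigmaZ_add3 -IHm; last lia.
rewrite /coefU1 (_ : (k.+2.+3 %% 3 = k.+2 %% 3)%N); last lia.
case: ifP => // _.
by rewrite (_ : (k.+2.+4 %/ 3 = (k.+3 %/ 3).+1)%N) ?exprS ?mulN1r//; lia.
Qed.

Lemma sumC_eq_sumU (k : nat) :
  sumC k = - (sigmaZ k)%:~R + sumU (k%:Z - 1) + sumU k%:Z.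
Proof.
have [m] := ubnP k; elim: m k => // m IHm [|[|k]] km.
- by rewrite sumC0 !sumU_neg// oppr0 !addr0.
- rewrite sumC_rec// sumC0 sumU_rec// !sumU_neg//.
  by rewrite /= !(add0r, addr0, oppr0) !mulr1.
rewrite sumC_rec// subSS subn1 !succnK.
rewrite !IHm; [|lia..].
rewrite (sumU_rec (k := k.+2))//.
rewrite coefU1E sigmaZ_rec.
have -> : k.+1%:Z - 1 = k%:Z by lia.
have -> : k.+2%:Z - 1 = k.+1%:Z by lia.
have -> : k.+2%:Z - 3 = k%:Z - 1 by lia.
have -> : k.+2%:Z - 2 = k%:Z by lia.
rewrite addr0 rmorphB rmorphN /= mulrDl mulN1r.
rewrite [_ + _ - (sigmaZ k)%:~R]addrC !addrA; congr (_ + _).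
rewrite !opprD !opprK !addrA.
(* This order puts [sumU k] next to its opposite, at the end of the sum. *)
by rewrite [LHS](ACl (1 * 4 * 3 * 5 * 2 * 6))/= addrK.
Qed.

End Sums.

(** * The three identities *)

Theorem corollary22 (R : realType) (k : nat) :
  exists s : int,
    [/\ s%:~R = sigma R k,
        \sum_(l \in C k) \prod_(i <- l) (-1 + a i)
          = - s%:~R
            + \sum_(l \in U (k%:Z - 1)) (-1) ^+ g (k%:Z - 1) l * monomial l
            + \sum_(l \in U k%:Z) (-1) ^+ g k%:Z l * monomial l,
        \sum_(l \in C k) ((-1) ^+ size l : int) = - s
      & - s + \sum_(l \in U (k%:Z - 1)) ((-1) ^+ g (k%:Z - 1) l : int)
            + \sum_(l \in U k%:Z) ((-1) ^+ g k%:Z l : int) = 0].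
Proof.
exists (sigmaZ k); split.
- exact: sigmaZE.
- exact: sumC_eq_sumU a k.
- have U0 j : sumU (fun _ => 0 : int) j = 0.
    apply: fsbig1 => -[|y l] [] // _ _ _ _ _.
    by rewrite big_cons mul0r mulr0.
  have := sumC_eq_sumU (fun _ => 0 : int) k.
  rewrite !U0 !addr0 intz => <-; apply: eq_fsbigr => l _.
  by rewrite addr0 big_const_seq count_predT iter_mulr_1.
- have U1 j : sumU (fun _ => 1 : int) j = \sum_(l \in U j) ((-1) ^+ g j l : int).
    by apply: eq_fsbigr => l _; rewrite big1// mulr1.
  have := sumC_eq_sumU (fun _ => 1 : int) k.
  rewrite !U1 intz => <-; apply: fsbig1 => -[|y l] [] // _ _ _ _.
  by rewrite big_cons mul0r.
Qed.
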